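(* Let $F=G+H$ be as in the context, where each $h_j:\mathbb{R}^n\to\mathbb{R}$ is continuously differentiable, each $g_j:\mathbb{R}^n\to\mathbb{R}\cup\{+\infty\}$ is proper, convex and lower semicontinuous, and $\mathrm{dom}(G)$ is convex and compact. Assume in addition that, for every $j\in\mathcal{J}$, $\nabla h_j$ is Lipschitz continuous with constant $L_j>0$ and $h_j$ is convex, and let $L=\max_{j\in\mathcal{J}}L_j$. Let $(x^k)_{k\in\mathbb{N}}$ be an infinite sequence generated by the generalized conditional gradient method (so that $\theta(x^k)<0$ for all $k$) with $\lambda_k$ given by the adaptive step size or by the diminishing step size. Assume that $\lim_{k\to\infty}F(x^k)=F(x^* )$ for some $x^*\in\mathrm{dom}(G)$. Then $$\min_{\ell\in\{\lfloor k/2\rfloor+2,\dots,k\}}|\theta(x^\ell)|\le\frac{8L\Omega^2}{k-2},\qquad k=3,4,\dots.$$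
   Context: $\mathcal{J}=\{1,\dots,m\}$, $\mathbb{N}=\{0,1,2,\dots\}$, $\|\cdot\|$ is the Euclidean norm, and $\lfloor k/2\rfloor=\max\{n\in\mathbb{N}: n\le k/2\}$. $F=(f_1,\dots,f_m)$, $f_j=g_j+h_j$, $G=(g_1,\dots,g_m)$, $H=(h_1,\dots,h_m)$, $\mathrm{dom}(G)=\{x\in\mathbb{R}^n: g_j(x)<+\infty\text{ for all }j\in\mathcal{J}\}$. $\Omega>0$ is a fixed number with $\Omega\ge\mathrm{diam}(\mathrm{dom}(G))$. For $x\in\mathrm{dom}(G)$, $\theta(x):=\min_{u\in\mathbb{R}^n}\max_{j\in\mathcal{J}}\big(g_j(u)-g_j(x)+\langle\nabla h_j(x),u-x\rangle\big)\le 0$, and $p(x)\in\mathrm{dom}(G)$ denotes a point $u$ attaining this minimum. Generalized conditional gradient method: choose $x^0\in\mathrm{dom}(G)$; for $k=0,1,\dots$ compute a minimizer $p(x^k)$ and the value $\theta(x^k)$; stop if $\theta(x^k)=0$; otherwise compute a step size $\lambda_k\in(0,1]$ and set $x^{k+1}:=x^k+\lambda_k(p(x^k)-x^k)$. Adaptive step size: $\lambda_k:=\min\Big\{1,\dfrac{|\theta(x^k)|}{L\|p(x^k)-x^k\|^2}\Big\}$. Diminishing step size: $\lambda_k:=\dfrac{2}{k+2}$. *)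

(* Defs.v *)
From HB Require Import structures.
From mathcomp Require Export all_boot all_order all_algebra.
From mathcomp Require Export all_classical all_reals all_analysis.
Export Order.TTheory GRing.Theory Num.Theory.
Export numFieldNormedType.Exports.

Set Implicit Arguments.
Unset Strict Implicit.
Unset Printing Implicit Defensive.

Global Open Scope classical_set_scope.
Global Open Scope ring_scope.

Section euclidean.
Context {R : realType} {n : nat}.
Implicit Types (x y u v : 'rV[R]_n) (A : set 'rV[R]_n).

Definition dotp u v : R := \sum_(i < n) u 0 i * v 0 i.

(* The library norm `|x| on 'rV[R]_n is the sup norm; it is only used through
   the topology it induces, which is the usual one. *)
Definition enorm x : R := Num.sqrt (dotp x x).

Definition diam A : \bar R := ereal_sup [set (enorm (x - y))%:E | x in A & y in A].

Definition gradient (f : 'rV[R]_n -> R) x : 'rV[R]_n :=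
  \row_i 'D_(delta_mx 0 i) (f : _ -> R^o) x.

Definition C1 (f : 'rV[R]_n -> R) : Prop :=
  (forall x, differentiable (f : _ -> R^o) x) /\ continuous (gradient f).

Definition lipschitz_gradient (L : R) (f : 'rV[R]_n -> R) : Prop :=
  forall x y, enorm (gradient f x - gradient f y) <= L * enorm (x - y).

Definition proper_fun (g : 'rV[R]_n -> \bar R) : Prop :=
  (forall x, g x != -oo%E) /\ exists x, (g x < +oo)%E.

(* The library's convex_function is for real-valued functions only. *)
Definition convex_efun (g : 'rV[R]_n -> \bar R) : Prop :=
  forall x y (t : R), 0 < t < 1 ->
    (g (t *: x + (1 - t) *: y)%R <= t%:E * g x + (1 - t)%:E * g y)%E.

End euclidean.

Section composite.
Context {R : realType} {n m : nat}.
Variables (g : 'I_m -> 'rV[R]_n -> \bar R) (h : 'I_m -> 'rV[R]_n -> R).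
Implicit Types x u p : 'rV[R]_n.

Definition domG : set 'rV[R]_n := [set x | forall j, (g j x < +oo)%E].

Definition objective (j : 'I_m) x : \bar R := (g j x + (h j x)%:E)%E.

Definition model x u : \bar R :=
  \big[maxe/-oo%E]_(j < m) (g j u - g j x + (dotp (gradient (h j) x) (u - x)%R)%:E)%E.

Definition theta x : \bar R := ereal_inf (range (model x)).

Definition is_minimizer x p : Prop := domG p /\ model x p = theta x.

(* An infinite run: x k are the iterates, p k the minimizer computed at x k
   and lam k the step size; the stopping test never succeeds. *)
Definition gcg_run (lam : nat -> R) (x p : nat -> 'rV[R]_n) : Prop :=
  domG (x 0%N) /\
  forall k, [/\ is_minimizer (x k) (p k),
                (theta (x k) < 0)%E,
                0 < lam k <= 1 &
                x k.+1 = x k + lam k *: (p k - x k)].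

(* theta (x k) is a finite number along a run, so fine is harmless. *)
Definition adaptive_step (L : R) (lam : nat -> R) (x p : nat -> 'rV[R]_n) : Prop :=
  forall k, lam k =
    Num.min 1 (`|fine (theta (x k))| / (L * enorm (p k - x k) ^+ 2)).

End composite.

Definition diminishing_step {R : realType} (lam : nat -> R) : Prop :=
  forall k, lam k = 2 / (k%:R + 2).

(* Main.v *)
Require Import Defs.
From mathcomp Require Import ring lra zify.

Set Implicit Arguments.
Unset Strict Implicit.
Unset Printing Implicit Defensive.

(** Write t_k = |theta(x^k)|, C = L * Omega^2, mu_k = 2 / (k + 2) and
    d_j(k) = F_j(x^k) - F_j(xs). Three facts about the run carry the proof.

    - Decrease: d_j(k+1) <= d_j(k) - mu_k t_k + mu_k^2 C / 2 for every j
      ([fobjective_step] together with [truncated_step_le]). Convexity of g_j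
      and the descent lemma for h_j give such a bound with the step lambda_k
      and |p - x|^2 in place of mu_k and Omega^2. The adaptive step minimizes
      the right-hand side over [0, 1], so the same bound with the comparison
      step mu_k follows; the diminishing step is mu_k itself. Hence a single
      analysis covers both step rules.
    - Gap: d_j(k) <= t_k for some j, by testing the minimization that defines
      theta at u = xs and using convexity of h_j ([thetaP],
      [model_term_le]).
    - d_j(k) tends to 0 for every j, by assumption.

    The rest concerns real sequences. Decrease and gap give by induction an
    index j with d_j(k) <= 2 C / (k + 2) for each k >= 1 ([gap_rate]). Since the error terms
    mu_k^2 C / 2 = 2 C / (k + 2)^2 telescope, the potential
    e_j(k) = d_j(k) + 2 C / (k + 1) satisfies e_j(k+1) <= e_j(k) - mu_k t_k,
    and it tends to 0, so it is nonnegative. This replaces the inequality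
    F_j(x^k) >= F_j(xs), which may fail for the diminishing step.
    Consequently the sum of mu_l t_l over l = s, ..., k with
    s = floor(k / 2) + 2 is at most e_j(s), which is at most 8 C / (k + 3) for
    the j with small gap, whereas it would exceed 8 C / (k + 2) if every t_l in
    this window were larger than 8 C / (k - 2) ([exists_small_gap]). *)

(** * The Euclidean inner product *)

Section dot.
Context {R : realType} {n : nat}.
Implicit Types u v w : 'rV[R]_n.

Lemma dotp_ge0 u : 0 <= dotp u u.
Proof. by apply: sumr_ge0 => i _; rewrite -expr2 sqr_ge0. Qed.

Lemma sqr_enorm u : enorm u ^+ 2 = dotp u u.
Proof. by rewrite sqr_sqrtr ?dotp_ge0. Qed.

Lemma enorm_ge0 u : 0 <= enorm u.
Proof. exact: sqrtr_ge0. Qed.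

Lemma dotpBl u v w : dotp (u - v) w = dotp u w - dotp v w.
Proof.
by rewrite /dotp -sumrB; apply: eq_bigr => i _; rewrite !mxE mulrBl.
Qed.

Lemma dotpZr a u v : dotp u (a *: v) = a * dotp u v.
Proof.
by rewrite /dotp mulr_sumr; apply: eq_bigr => i _; rewrite !mxE mulrCA.
Qed.

Lemma enormZ a u : 0 <= a -> enorm (a *: u) = a * enorm u.
Proof.
move=> a0; apply/eqP; rewrite -(@eqrXn2 _ 2) ?mulr_ge0 ?enorm_ge0 //.
rewrite exprMn !sqr_enorm dotpZr; apply/eqP.
rewrite expr2 -mulrA; congr (_ * _).
by rewrite /dotp mulr_sumr; apply: eq_bigr => i _; rewrite !mxE mulrA.
Qed.

(** Cauchy-Schwarz. *)
Lemma dotp_le_enorm u v : dotp u v <= enorm u * enorm v.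
Proof.
have sq a b : 2 * (a * b * dotp u v) <= b ^+ 2 * dotp u u + a ^+ 2 * dotp v v.
  rewrite -subr_ge0.
  suff <- : dotp (b *: u - a *: v) (b *: u - a *: v) =
    b ^+ 2 * dotp u u + a ^+ 2 * dotp v v - 2 * (a * b * dotp u v).
    exact: dotp_ge0.
  rewrite /dotp !mulr_sumr -big_split -sumrB.
  by apply: eq_bigr => i _; rewrite !mxE /=; ring.
(* The choice a = <u, v>, b = |v|^2 proves the squared inequality when v <> 0. *)
suff : dotp u v ^+ 2 <= (enorm u * enorm v) ^+ 2.
  have : 0 <= enorm u * enorm v by rewrite mulr_ge0 ?enorm_ge0.
  by case: leP => //; nra.
rewrite exprMn !sqr_enorm.
have := dotp_ge0 u; have := dotp_ge0 v.
move: sq; set U := dotp u u; set V := dotp v v; set D := dotp u v => sq V0 U0.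
have [Vz|Vn] := eqVneq V 0.
  (* Here 2 (U + 1) D^2 <= U D^2, which forces D = 0. *)
  by have := sq (U + 1) D; rewrite Vz; nra.
have Vp : 0 < V by rewrite lt_neqAle eq_sym Vn V0.
by rewrite -(ler_pM2l Vp); have := sq D V; nra.
Qed.
End dot.

(** * Differentiable functions along a line *)

Section ray.
Context {R : realType} {n : nat}.
Variable f : 'rV[R]_n -> R.
Hypothesis df : forall x, differentiable (f : _ -> R^o) x.
Implicit Types x v : 'rV[R]_n.

Lemma derive_gradient x v : 'D_v (f : _ -> R^o) x = dotp (gradient f x) v.
Proof.
rewrite deriveE // [v in LHS]row_sum_delta linear_sum /dotp.
by apply: eq_bigr => i _; rewrite linearZ /= mxE deriveE // mulrC.
Qed.

Lemma is_derive_ray x v (s : R) :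
  is_derive s 1 (fun t : R => f (x + t *: v) : R^o) (dotp (gradient f (x + s *: v)) v).
Proof.
have quot : (fun h : R => h^-1 *: ((f (x + (h *: (1 : R) + s) *: v) : R^o) - f (x + s *: v)))
    = (fun h => h^-1 *: ((f (h *: v + (x + s *: v)) : R^o) - f (x + s *: v))).
  apply/funext => t; congr (_ *: (f _ - _)).
  by rewrite scalerDl [t *: 1]mulr1 addrCA.
have := @diff_derivable _ _ _ _ _ v (df (x + s *: v)).
have := derive_gradient (x + s *: v) v.
rewrite /derive /derivable => dE dx.
by apply: DeriveDef; rewrite /derive /derivable /= quot.
Qed.

(** A convex function lies above its tangent: the difference quotients of f at
    x in direction v are at most f (x + v) - f x, and so is their limit. *)
Lemma gradient_le x v :
  (forall s : R, 0 < s <= 1 -> f (x + s *: v) <= (1 - s) * f x + s * f (x + v)) ->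
  dotp (gradient f x) v <= f (x + v) - f x.
Proof.
move=> cvx; have [dx] := is_derive_ray x v 0.
rewrite /derive scale0r addr0 => dE.
move: dx; rewrite /derivable scale0r addr0 => /cvg_dnbhs_at_right; rewrite dE => {dE} lim0.
apply: (cvgr_to_le lim0).
near=> s; rewrite /= [s%:A]mulr1 !addr0.
have s0 : 0 < s by [].
rewrite [s^-1 *: _]mulrC ler_pdivrMr //.
have := cvx s; rewrite s0 => /(_ _)/=.
have s1 : s <= 1 by near: s; exact: nbhs_right_le.
move=> /(_ s1); nra.
Unshelve. all: by end_near. Qed.

(** The function psi of the proof, f minus its quadratic upper model along
    the line up to a constant, has nonpositive derivative because the gradient moves
    by at most L t |v| between x and x + t v. *)
Lemma descent_lemma (L : R) x v (s : R) : lipschitz_gradient L f -> 0 <= s ->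
  f (x + s *: v) <= f x + s * dotp (gradient f x) v + s ^+ 2 * (L * enorm v ^+ 2 / 2).
Proof.
move=> lip s0.
set D := dotp (gradient f x) v; set Q := L * enorm v ^+ 2.
pose psi (t : R) : R := f (x + t *: v) - t * D - t ^+ 2 * (Q / 2).
pose dpsi (t : R) : R := dotp (gradient f (x + t *: v)) v - D - t * Q.
have dpsiE (t : R) : is_derive (t : R) (1 : R) psi (dpsi t).
  have d1 := is_derive_ray x v t.
  have dlin (c : R) : is_derive (t : R) (1 : R) (fun t : R => t * c) c.
    by apply: is_derive_eq; rewrite scaler0 add0r /GRing.scale /= mulr1.
  have dsqr (c : R) : is_derive (t : R) (1 : R) (fun t : R => t ^+ 2 * c) (t * (2 * c)).
    by apply: is_derive_eq; rewrite /GRing.scale /=; ring.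
  apply: is_derive_eq.
  by rewrite /dpsi; field.
have [c] : exists2 c, c \in `[0, s] & psi s - psi 0 = dpsi c * (s - 0).
  apply: (@MVT_segment R psi dpsi) => //.
  apply: (@continuous_subspaceT R R) => t; apply: differentiable_continuous.
  by apply/derivable1_diffP; case: (dpsiE t).
rewrite in_itv /= => /andP[c0 _].
rewrite /psi /dpsi scale0r !(mul0r, expr0n, subr0, addr0) /= => mvt.
suff : dpsi c * s <= 0 by rewrite /dpsi -/D; lra.
apply: mulr_le0_ge0 => //; rewrite /dpsi -dotpBl subr_le0.
apply: le_trans (dotp_le_enorm _ _) _.
have := lip (c *: v + x) x; rewrite addrK enormZ // [X in gradient f X]addrC => h.
by apply: le_trans (ler_wpM2r (enorm_ge0 v) h) _; rewrite /Q; lra.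
Qed.
End ray.

(** * The comparison step *)

(** The truncated quotient is the minimizer over the steps at most 1 of the
    quadratic upper bound of the decrease, so it does at least as well as any
    other step mu. *)
Lemma truncated_step_le (R : realFieldType) (t q mu : R) : 0 < q -> mu <= 1 ->
  let lam := Num.min 1 (t / q) in
  lam ^+ 2 * (q / 2) - lam * t <= mu ^+ 2 * (q / 2) - mu * t.
Proof.
move=> q0 mu1 /=; case: (leP 1 (t / q)).
  rewrite ler_pdivlMr // mul1r => qt.
  have : 0 <= (1 - mu) * (t - q) by rewrite mulr_ge0 // subr_ge0.
  by have := mulr_ge0 (ltW q0) (sqr_ge0 (1 - mu)); lra.
move=> _; rewrite -subr_ge0.
suff -> : mu ^+ 2 * (q / 2) - mu * t - ((t / q) ^+ 2 * (q / 2) - t / q * t)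
    = (mu - t / q) ^+ 2 * (q / 2) by rewrite mulr_ge0 ?sqr_ge0 // ltW // divr_gt0.
by field; rewrite gt_eqF.
Qed.

(** * The convergence rate for real sequences *)

(** The sequences [d j] stand for the objective gaps F_j(x^k) - F_j(xs), the
    sequence [t] for |theta(x^k)| and [C] for L * Omega^2. *)
Section rate.
Context {R : realType} {I : Type}.
Variables (d : I -> nat -> R) (t : nat -> R) (C : R).
Hypothesis C0 : 0 < C.
Hypothesis d_step : forall j k,
  d j k.+1 <= d j k - 2 / (k%:R + 2) * t k + (2 / (k%:R + 2)) ^+ 2 * (C / 2).
Hypothesis d_le_t : forall k, exists j, d j k <= t k.
Hypothesis d_cvg : forall j, d j k @[k --> \oo] --> (0 : R).

(** The usual induction of conditional gradient methods. As different indices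
    may realize the hypothesis on t_k and the induction hypothesis, the proof
    keeps the one with the smaller gap, which satisfies both. *)
Lemma gap_rate k : exists j, d j k.+1 <= 2 * C / (k.+1%:R + 2).
Proof.
have step j k' B : d j k' <= B -> d j k' <= t k' ->
    d j k'.+1 <= (1 - 2 / (k'%:R + 2)) * B + (2 / (k'%:R + 2)) ^+ 2 * (C / 2).
  move=> dB dt; apply: le_trans (d_step j k') _; rewrite lerD2r.
  have k0 : (0 : R) <= k'%:R by [].
  have mu0 : (0 : R) <= 2 / (k'%:R + 2) by rewrite divr_ge0 // addr_ge0.
  have mu1 : 2 / (k'%:R + 2) <= 1 :> R by rewrite ler_pdivrMr; lra.
  nra.
elim: k => [|k [j0 IH]].
  (* The first comparison step is 1, so the initial gap drops out. *)
  have [j dt] := d_le_t 0; exists j.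
  have := step j 0 (d j 0) (lexx _) dt.
  rewrite (_ : 1%:R = 1) // => h; apply: le_trans h _.
  rewrite [X in _ <= X](_ : _ = 2 / 3 * C); [|by field].
  rewrite add0r divff // subrr mul0r expr1n; have := C0; lra.
have [j [dIH dt]] : exists j, d j k.+1 <= 2 * C / (k.+1%:R + 2) /\ d j k.+1 <= t k.+1.
  have [j1 dt] := d_le_t k.+1.
  have [le10|lt01] := leP (d j1 k.+1) (d j0 k.+1).
    by exists j1; split => //; exact: le_trans IH.
  by exists j0; split => //; exact: le_trans (ltW lt01) dt.
exists j; apply: le_trans (step _ _ _ dIH dt) _.
rewrite -[k.+2%:R]natr1; move: (ler0n R k.+1); set z := k.+1%:R => z0.
rewrite -subr_ge0 [X in 0 <= X](_ : _ = 2 * C / ((z + 2) ^+ 2 * (z + 3))).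
  by have := C0 => C_gt0; rewrite divr_ge0 ?(mulr_ge0, exprn_ge0) //; lra.
by field; rewrite !gt_eqF //; lra.
Qed.

(** The added term majorizes the tail of the series of errors
    2 C / (l + 2)^2, l >= k. *)
Let e j k := d j k + 2 * C / (k%:R + 1).

Lemma potential_step j k : e j k.+1 <= e j k - 2 / (k%:R + 2) * t k.
Proof.
rewrite /e -[k.+1%:R]natr1; have := d_step j k; move: (ler0n R k); set z := k%:R => z0 step.
suff : (2 / (z + 2)) ^+ 2 * (C / 2) + 2 * C / (z + 1 + 1) <= 2 * C / (z + 1) by lra.
rewrite -subr_ge0 [X in 0 <= X](_ : _ = 2 * C / ((z + 2) ^+ 2 * (z + 1))).
  by have := C0 => C_gt0; rewrite divr_ge0 ?(mulr_ge0, exprn_ge0) //; lra.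
by field; rewrite !gt_eqF //; lra.
Qed.

(** A nonincreasing sequence is at least its limit, here 0. *)
Lemma potential_ge0 j k : (forall l, 0 <= t l) -> 0 <= e j k.
Proof.
move=> t0; have e_mono i : e j (k + i) <= e j k.
  elim: i => [|i IH]; first by rewrite addn0.
  rewrite addnS; apply: le_trans (potential_step _ _) (le_trans _ IH).
  by rewrite gerBl mulr_ge0 ?divr_ge0 ?addr_ge0.
have e_cvg : e j i @[i --> \oo] --> (0 : R).
  have harm : (fun i => 2 * C / (i%:R + 1)) @ \oo --> (0 : R).
    rewrite (_ : (fun i => _) = (fun i => 2 * C * harmonic i)); last first.
      by apply/funext => i; rewrite /harmonic /= natr1.
    rewrite -[X in _ --> X](mulr0 (2 * C)).
    by apply: cvgM; [exact: cvg_cst | exact: cvg_harmonic].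
  rewrite -[X in _ --> X](addr0 (0 : R)).
  exact: (cvgD (@d_cvg j) harm).
apply: (cvgr_to_le e_cvg); near=> i.
have ki : (k <= i)%N by near: i; exact: nbhs_infty_ge.
by rewrite -(subnKC ki).
Unshelve. all: by end_near. Qed.

(** The window has at least (k - 2) / 2 terms, and each weight in it is at least
    2 / (k + 2). If every t_l exceeded 8 C / (k - 2), the potential would lose
    at least 8 C / (k + 2) over the window, although it is nonnegative at the
    end and at most 2 C / (s + 2) + 2 C / (s + 1) at the start s >= (k + 3) / 2. *)
Lemma exists_small_gap k : (forall l, 0 <= t l) -> (3 <= k)%N ->
  exists2 l, (k./2 + 2 <= l < k.+1)%N & t l <= 8 * C / (k%:R - 2).
Proof.
move=> t0 k3; set s := (k./2 + 2)%N.
set tau := 8 * C / (k%:R - 2).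
apply: contrapT => no; have tau_lt l : (s <= l < k.+1)%N -> tau < t l.
  by move=> sl; rewrite ltNge; apply/negP => tl; apply: no; exists l.
have ks : (s <= k)%N by rewrite /s; lia.
(* [gap_rate] speaks of successors, and s is positive. *)
have [j gap] := gap_rate s.-1.
have decr i : (s + i <= k.+1)%N -> e j (s + i) <= e j s - i%:R * (2 / (k%:R + 2)) * tau.
  elim: i => [|i IH] sik; first by rewrite addn0 !mul0r subr0.
  have := IH (ltnW _); rewrite -addnS => /(_ sik) {}IH.
  have := potential_step j (s + i); rewrite addnS => st.
  apply: le_trans st _; rewrite -[i.+1%:R]natr1.
  suff : 2 / (k%:R + 2) * tau <= 2 / ((s + i)%:R + 2) * t (s + i)%N by lra.
  apply: ler_pM.
  - by rewrite divr_ge0 ?addr_ge0.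
  - by rewrite /tau divr_ge0 ?mulr_ge0 // ?ltW // subr_gt0 ltr_nat.
  - rewrite ler_pM2l // lef_pV2 ?posrE ?ltr_wpDl // lerD2r ler_nat; lia.
  - by apply/ltW/tau_lt; lia.
have := decr (k.+1 - s)%N; rewrite subnKC ?(leqW ks) // => /(_ (leqnn _)).
have := potential_ge0 j k.+1 t0.
have C_gt0 := C0.
have k2 : 0 < k%:R - 2 :> R by rewrite subr_gt0 ltr_nat.
have sk : k%:R + 3 <= 2 * s%:R :> R by rewrite -natrD -natrM ler_nat /s; lia.
have Nk : k%:R - 2 <= 2 * (k.+1 - s)%:R :> R.
  by rewrite lerBlDr -natrM -natrD ler_nat /s; lia.
move: gap; rewrite prednK; last by rewrite /s addn2.
rewrite /e.
have -> : (k.+1 - s)%:R * (2 / (k%:R + 2)) * tau =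
    2 * (k.+1 - s)%:R / (k%:R - 2) * (8 * C / (k%:R + 2)).
  by rewrite /tau; field; rewrite !gt_eqF //; lra.
move: sk Nk k2; set z : R := k%:R; set y : R := s%:R; set N : R := (_ - _)%:R => sk Nk k2 gap.
have gain : 8 * C / (z + 2) <= 2 * N / (z - 2) * (8 * C / (z + 2)).
  apply: ler_peMl; first by rewrite divr_ge0 //; lra.
  by rewrite ler_pdivlMr // mul1r.
have half : 4 * C / (z + 3) = 2 * C / ((z + 3) / 2) by field; rewrite gt_eqF //; lra.
have le1 : 2 * C / (y + 2) <= 4 * C / (z + 3).
  by rewrite half ler_pM2l ?lef_pV2 ?posrE; lra.
have le2 : 2 * C / (y + 1) <= 4 * C / (z + 3).
  by rewrite half ler_pM2l ?lef_pV2 ?posrE; lra.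
have lt : 8 * C / (z + 3) < 8 * C / (z + 2).
  rewrite ltr_pM2l ?ltf_pV2 ?posrE; lra.
have : 4 * C / (z + 3) + 4 * C / (z + 3) = 8 * C / (z + 3) by field; rewrite gt_eqF //; lra.
lra.
Qed.
End rate.

(** * One step of the method *)

Section composite.
Context {R : realType} {n m : nat}.
Variables (g : 'I_m -> 'rV[R]_n -> \bar R) (h : 'I_m -> 'rV[R]_n -> R).
Hypothesis g_proper : forall j, proper_fun (g j).
Implicit Types (x y u p : 'rV[R]_n).

(** The j-th entry of the maximum that defines [model], as a real number on
    [domG g]. *)
Definition model_term j x u : R :=
  fine (g j u) - fine (g j x) + dotp (gradient (h j) x) (u - x).

Definition fobjective j x : R := fine (g j x) + h j x.

Lemma domG_fin_num j x : domG g x -> g j x \is a fin_num.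
Proof.
by move=> /(_ j) gx; rewrite fin_numE (proj1 (g_proper j)) lt_eqF.
Qed.

Lemma objectiveE j x : domG g x -> objective g h j x = (fobjective j x)%:E.
Proof. by move=> gx; rewrite /objective /fobjective EFinD fineK ?domG_fin_num. Qed.

Lemma modelE x u : domG g x -> domG g u ->
  model g h x u = \big[maxe/-oo%E]_(j < m) (model_term j x u)%:E.
Proof.
move=> gx gu; apply: eq_bigr => j _.
by rewrite /model_term EFinD EFinB !fineK ?domG_fin_num.
Qed.

(** At an iterate theta is finite, because p attains it and p lies in the
    domain. Its two defining properties, being the maximum of the terms at p and
    a lower bound of the model at every u, are then statements about reals. *)
Lemma thetaP x p : (0 < m)%N -> domG g x -> is_minimizer g h x p -> (theta g h x < 0)%E ->
  exists2 t : R, 0 < t & [/\ theta g h x = (- t)%:E,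
    forall j, model_term j x p <= - t &
    forall u, domG g u -> exists j, - t <= model_term j x u].
Proof.
move=> m0 gx [gp mp] th0.
have j0 : 'I_m := Ordinal m0.
have max_at u : domG g u -> exists j, model g h x u = (model_term j x u)%:E.
  move=> gu; rewrite modelE //.
  have [j _ ->] := @eq_bigmax _ _ _ -oo%E j0 predT (fun j => (model_term j x u)%:E)
    isT (fun j _ => leNye _).
  by exists j.
have [j1 mj1] := max_at p gp.
have thE : theta g h x = (- - model_term j1 x p)%:E by rewrite opprK -mp.
exists (- model_term j1 x p).
  by move: th0; rewrite thE opprK lte_fin oppr_gt0.
split=> // [j|u gu].
  rewrite opprK -lee_fin -mj1 modelE //.
  exact: (@le_bigmax _ _ _ -oo%E (fun j => (model_term j x p)%:E)).
have [j mj] := max_at u gu; exists j.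
rewrite -lee_fin -mj -thE; apply: ereal_inf_lbound.
by exists u.
Qed.

Lemma enorm_diam_le Omega x y : (diam (domG g) <= Omega%:E)%E ->
  domG g x -> domG g y -> enorm (x - y) <= Omega.
Proof.
move=> dO gx gy; rewrite -lee_fin; apply: le_trans dO.
by apply: ereal_sup_ubound; exists x => //; exists y.
Qed.

Hypothesis g_convex : forall j, convex_efun (g j).

(** [convex_efun] speaks of 0 < t < 1 only; the step s = 1 is covered here. *)
Lemma segment_le x p (s : R) j : domG g x -> domG g p -> 0 < s <= 1 ->
  (g j (x + s *: (p - x)) <= ((1 - s) * fine (g j x) + s * fine (g j p))%:E)%E.
Proof.
move=> gx gp /andP[s0]; rewrite le_eqVlt => /predU1P[->|s1].
  by rewrite scale1r addrC subrK subrr mul0r add0r mul1r fineK ?domG_fin_num.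
have := @g_convex j p x s; rewrite s0 s1 => /(_ isT).
rewrite (_ : s *: p + (1 - s) *: x = x + s *: (p - x)); last first.
  by rewrite scalerBl scalerBr scale1r addrCA.
by rewrite addeC (EFinD (_ * _)) !EFinM !fineK ?domG_fin_num.
Qed.

Lemma segment_domG x p (s : R) : domG g x -> domG g p -> 0 < s <= 1 ->
  domG g (x + s *: (p - x)).
Proof.
move=> gx gp s01 j; exact: le_lt_trans (segment_le j gx gp s01) (ltry _).
Qed.

(** Convexity of g_j along the segment, plus the descent lemma for h_j. *)
Lemma fobjective_step (L : R) x p (s : R) j :
  C1 (h j) -> lipschitz_gradient L (h j) ->
  domG g x -> domG g p -> 0 < s <= 1 ->
  fobjective j (x + s *: (p - x)) <=
    fobjective j x + s * model_term j x p + s ^+ 2 * (L * enorm (p - x) ^+ 2 / 2).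
Proof.
move=> [dh _] lip gx gp s01.
have gy := segment_domG gx gp s01.
have := segment_le j gx gp s01; rewrite -(fineK (domG_fin_num j gy)) lee_fin.
have s0 : 0 <= s by case/andP: s01 => /ltW.
have := descent_lemma dh x (p - x) lip s0.
rewrite /fobjective /model_term; lra.
Qed.

(** By convexity of h_j the linearization underestimates the variation of F_j. *)
Lemma model_term_le x u j :
  C1 (h j) -> convex_function [set: convex_lmodType 'rV[R]_n] (h j) ->
  model_term j x u <= fobjective j u - fobjective j x.
Proof.
move=> [dh _] cvx.
have : dotp (gradient (h j) x) (u - x) <= h j (x + (u - x)) - h j x.
  apply: gradient_le => // s /andP[s0 s1].
  have := cvx (Itv01 (ltW s0) s1) u x; rewrite !in_setT => /(_ isT isT) cvx_s.
  have {cvx_s} : h j (s *: u + (1 - s) *: x) <= s * h j u + (1 - s) * h j x := cvx_s.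
  rewrite [x + (u - x)]addrC subrK.
  rewrite (_ : s *: u + (1 - s) *: x = x + s *: (u - x)); last first.
    by rewrite scalerBl scalerBr scale1r addrCA.
  by rewrite [X in _ <= X]addrC.
rewrite [x + (u - x)]addrC subrK /fobjective /model_term; lra.
Qed.
End composite.

Theorem theorem17 (R : realType) (n m : nat) (hm : (0 < m)%N)
  (g : 'I_m -> 'rV[R]_n -> \bar R) (h : 'I_m -> 'rV[R]_n -> R)
  (Lj : 'I_m -> R) (L Omega : R)
  (hC1 : forall j, C1 (h j))
  (g_proper : forall j, proper_fun (g j))
  (g_convex : forall j, convex_efun (g j))
  (g_lsc : forall j, lower_semicontinuous (g j))
  (dom_convex : convex_set (domG g : set (convex_lmodType 'rV[R]_n)))
  (dom_compact : compact (domG g))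
  (Omega_gt0 : 0 < Omega) (Omega_diam : (diam (domG g) <= Omega%:E)%E)
  (Lj_gt0 : forall j, 0 < Lj j)
  (h_lip : forall j, lipschitz_gradient (Lj j) (h j))
  (h_convex : forall j,
     convex_function [set: convex_lmodType 'rV[R]_n] (h j))
  (L_max : L = \big[Num.max/0]_(j < m) Lj j)
  (lam : nat -> R) (x p : nat -> 'rV[R]_n)
  (run : gcg_run g h lam x p)
  (step : adaptive_step g h L lam x p \/ diminishing_step lam)
  (xs : 'rV[R]_n) (xs_dom : domG g xs)
  (F_cvg : forall j, objective g h j (x k) @[k --> \oo] --> objective g h j xs) :
  forall k : nat, (3 <= k)%N ->
    (\big[mine/+oo]_(k./2 + 2 <= l < k.+1) `|theta g h (x l)|
       <= (8 * L * Omega ^+ 2 / (k%:R - 2))%:E)%E.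
Proof.
have [x0 steps] := run.
have m0 : 'I_m := Ordinal hm.
have Lj_le j : Lj j <= L by rewrite L_max; exact: le_bigmax.
have L_gt0 : 0 < L by exact: lt_le_trans (Lj_gt0 m0) (Lj_le m0).
have xdom k : domG g (x k).
  elim: k => // k IH; have [[gp _] _ lam01 ->] := steps k.
  exact: segment_domG.
pose t k := - fine (theta g h (x k)).
have tP k : [/\ 0 < t k, theta g h (x k) = (- t k)%:E,
    forall j, model_term g h j (x k) (p k) <= - t k &
    forall u, domG g u -> exists j, - t k <= model_term g h j (x k) u].
  have [mp th0 _ _] := steps k.
  have [s s0 [thE le_s ge_s]] := thetaP g_proper hm (xdom k) mp th0.
  by have -> : t k = s by rewrite /t thE /= opprK.
pose C := L * Omega ^+ 2.
have C_gt0 : 0 < C by rewrite mulr_gt0 ?exprn_gt0.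
pose d j k := fobjective g h j (x k) - fobjective g h j xs.
have d_step j k :
    d j k.+1 <= d j k - 2 / (k%:R + 2) * t k + (2 / (k%:R + 2)) ^+ 2 * (C / 2).
  have [[gp _] _ lam01 xE] := steps k.
  have [t_gt0 thE lin_le _] := tP k.
  set D := enorm (p k - x k).
  have D_ge0 : 0 <= D := enorm_ge0 _.
  have D_le : D <= Omega by exact: (enorm_diam_le Omega_diam gp (xdom k)).
  have lipL : lipschitz_gradient L (h j).
    by move=> y z; apply: le_trans (h_lip j y z) _; rewrite ler_wpM2r ?enorm_ge0.
  have := fobjective_step g_proper g_convex (hC1 j) lipL (xdom k) gp lam01.
  rewrite -xE -/D => obj_step.
  have [lam0 lam1] := andP lam01.
  have lamt : lam k * model_term g h j (x k) (p k) <= lam k * - t k.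
    by rewrite ler_pM2l.
  set mu := 2 / (k%:R + 2).
  have mu1 : mu <= 1.
    by rewrite ler_pdivrMr ?mul1r ?lerDr ?ltr_wpDl.
  suff : lam k ^+ 2 * (L * D ^+ 2 / 2) - lam k * t k <= mu ^+ 2 * (C / 2) - mu * t k.
    by rewrite /d; lra.
  have q_le : L * D ^+ 2 <= C by rewrite ler_pM2l // ler_pXn2r // nnegrE ltW.
  apply: (@le_trans _ _ (mu ^+ 2 * (L * D ^+ 2 / 2) - mu * t k)); last first.
    by rewrite lerD2r ler_wpM2l ?sqr_ge0 // ler_pM2r.
  (* The diminishing step is the comparison step; only the adaptive one needs work. *)
  case: step => [adaptive|dim]; last by rewrite dim.
  have lamE : lam k = Num.min 1 (t k / (L * D ^+ 2)).
    by rewrite adaptive thE /= normrN gtr0_norm.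
  rewrite lamE; apply: truncated_step_le => //.
  rewrite mulr_gt0 // exprn_gt0 // lt_neqAle D_ge0 andbT eq_sym.
  (* If p = x the adaptive formula divides by 0 and gives lam = 0. *)
  apply/negP => /eqP Dz; move: lam0; rewrite lamE Dz expr0n mulr0 invr0 mulr0.
  by rewrite lt_min ltxx andbF.
have d_le_t k : exists j, d j k <= t k.
  have [_ _ _ /(_ _ xs_dom) [j lin_ge]] := tP k; exists j.
  have := model_term_le g (x k) xs (hC1 j) (@h_convex j).
  by rewrite /d; lra.
have d_cvg j : d j k @[k --> \oo] --> (0 : R).
  have Fcv : fobjective g h j (x k) @[k --> \oo] --> fobjective g h j xs.
    have FE : (fun k => fobjective g h j (x k)) = fine \o (fun k => objective g h j (x k)).
      by apply/funext => i /=; rewrite objectiveE.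
    by rewrite FE; apply: fine_cvg; rewrite -objectiveE.
  rewrite -[X in _ --> X](subrr (fobjective g h j xs)).
  by apply: cvgB; [exact: Fcv | exact: cvg_cst].
move=> k k3.
have t_ge0 l : 0 <= t l by have [/ltW] := tP l.
have [l lk tl] := exists_small_gap C_gt0 d_step d_le_t d_cvg t_ge0 k3.
apply: (bigmin_inf_seq _ l) => //; first by rewrite mem_index_iota.
have [t0 -> _ _] := tP l.
by rewrite /= normrN gtr0_norm // lee_fin -(mulrA 8).
Qed.
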